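(* Let $(V,E,\Phi)$ be a graph with Euclidean edges that is a tree (i.e. $(V,E)$ is a tree) and let $L$ be its associated network. Then the Delaunay relation satisfies the Baddeley--Møller consistency conditions on the family of configurations in general position. That is, let $\mathbf{z}\subset L$ be a finite configuration, $\mathbf{y}\subseteq\mathbf{z}$, and $u,v\in L$ with $u,v\notin\mathbf{z}$. Then: (C1) if $\mathbf{z}\cup\{u\}$ is in general position and $\chi(\mathbf{y}\mid\mathbf{z})\neq\chi(\mathbf{y}\mid\mathbf{z}\cup\{u\})$, then $\mathbf{y}\subseteq N(\{u\}\mid\mathbf{z}\cup\{u\})$; (C2) if $\mathbf{x}=\mathbf{z}\cup\{u,v\}$ is in general position and $u\not\sim_{\mathbf{x}}v$, then $$\chi(\mathbf{y}\mid\mathbf{z}\cup\{u\})+\chi(\mathbf{y}\mid\mathbf{z}\cup\{v\})=\chi(\mathbf{y}\mid\mathbf{z})+\chi(\mathbf{y}\mid\mathbf{x}).$$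
   Context: **Graph with Euclidean edges.** A graph with Euclidean edges in $\mathbb{R}^2$ is a triple $(V,E=(e_i)_{i=1}^{n(E)},\Phi=(\phi_i)_{i=1}^{n(E)})$ such that $(V,E)$ is a finite, simple (no loops, no multiple edges), connected graph with $V\subset\mathbb{R}^2$, and every edge $e_i=\{v_i^1,v_i^2\}\in E$ is parametrised by the inverse of a bijection $\phi_i$: $\phi_i^{-1}:J_i\to\mathbb{R}^2$ for a non-empty open interval $J_i\subset\mathbb{R}$ with (finite) endpoints $\phi_i(v_i^j)$, $j=1,2$ (so $\phi_i^{-1}$ extends to the closed interval $\bar J_i$ and maps its endpoints to the endpoints of $e_i$). The parametrisations are assumed to be diffeomorphisms onto their images. **Network.** $L=(\{0\}\times V)\cup\bigcup_{i=1}^{n(E)}(\{i\}\times\phi_i^{-1}(J_i))$. Labels identify edges, so edge interiors with different labels are disjoint in $L$ even if the curves overlap in $\mathbb{R}^2$. **Length and distance.** The length of $\phi_i^{-1}(B)$, $B\subseteq\bar J_i$ Borel, is the Euclidean length of $B$; in particular $e_i$ has length $|J_i|$. A walk between two elements $(i,x)$, $(j,y)$ of $L$ travels alternatingly along a finite number of vertices and edges, such that the vertices are endpoints of the edges; if $i\neq0$ it starts along a piece of edge $i$ from $x$, and if $j\neq0$ it ends along a piece of edge $j$ to $y$; it does not reverse its tracks within an edge. A path between two different elements is a walk in which all edge segments are different (non-overlapping) and all vertices are different. The weight of a path is the sum of the lengths of its edge segments. The (weighted) shortest path distance $d_G$ between two elements of $L$ is the smallest weight of a path between them (and $0$ if they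 are equal); $d_G$ is a metric. **Delaunay relation.** For a finite configuration $\mathbf{x}\subseteq L$ of distinct points and $x_j\in\mathbf{x}$, the Voronoi cell is $C(x_j\mid\mathbf{x})=\{\eta\in L: d_G(\eta,x_j)\le d_G(\eta,x)\text{ for all }x\in\mathbf{x}\}$. The Delaunay relation on $\mathbf{x}$ is $x_1\sim_{\mathbf{x}}x_2\Leftrightarrow C(x_1\mid\mathbf{x})\cap C(x_2\mid\mathbf{x})\neq\emptyset$. For $\mathbf{z}\subseteq\mathbf{x}$, $N(\mathbf{z}\mid\mathbf{x})=\{x\in\mathbf{x}:x\sim_{\mathbf{x}}z\text{ for some }z\in\mathbf{z}\}$. A subset $\mathbf{y}\subseteq\mathbf{x}$ is an $\mathbf{x}$-clique if $y_1\sim_{\mathbf{x}}y_2$ for all $y_1,y_2\in\mathbf{y}$ (the empty set and singletons are cliques). $\chi(\mathbf{y}\mid\mathbf{x})=1$ if $\mathbf{y}$ is an $\mathbf{x}$-clique and $0$ otherwise. **General position.** A configuration is in general position if no three of its points lie on the boundary of the same $d_G$-ball, i.e. there are no $c\in L$, $r>0$ and three distinct points of the configuration all at $d_G$-distance exactly $r$ from $c$. Subsets of configurations in general position are in general position. *)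

(* Defs.v *)
From HB Require Import structures.
From mathcomp Require Import all_boot all_order all_algebra finmap.
From mathcomp Require Import all_classical all_reals all_analysis.

Set Implicit Arguments.
Unset Strict Implicit.
Unset Printing Implicit Defensive.

Import Order.TTheory GRing.Theory Num.Theory.
Import numFieldNormedType.Exports.

Local Open Scope classical_set_scope.
Local Open Scope ring_scope.

Section CombinatorialGraph.
Variables (T : choiceType) (V : {fset T}) (n : nat) (E : 'I_n -> {fset T}).

Definition simple_graph : Prop :=
  injective E /\ forall i, (E i `<=` V)%fset /\ #|` E i| = 2%N.

Definition adj : rel T := fun u v => [exists i, E i == [fset u; v]%fset].

Definition connected_graph : Prop :=
  {in V &, forall u v, exists2 p, path adj u p & last u p = v}.

(* For a simple graph, [:: u; v] with u and v adjacent satisfies [cycle]; it is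
   not a graph cycle, whence the bound 2. *)
Definition acyclic_graph : Prop :=
  forall c : seq T, uniq c -> cycle adj c -> (size c <= 2)%N.

Definition tree_graph : Prop := connected_graph /\ acyclic_graph.

End CombinatorialGraph.

(* [f] is a bijection from the open interval ]a, b[ onto its image, with inverse
   [g]; [f] and [g] are both differentiable. The image need not be open in the
   plane, so differentiability of [g] means that, locally, it is the restriction
   of a differentiable function on the plane. No higher order of
   differentiability is required. *)
Definition diffeo_onto_image (R : realType) (a b : R)
    (f : R -> 'rV[R]_2) (g : 'rV[R]_2 -> R) : Prop :=
  [/\ {in `]a, b[, cancel f g},
      {in `]a, b[, forall t, differentiable f t} &
      {in `]a, b[, forall t, exists h : 'rV[R]_2 -> R,
         \forall p \near f t, differentiable h p /\
           ((f @` `]a, b[) p -> h p = g p)}].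

(* [phi i] is only meaningful on the closed edge [par i @` `[lo i, hi i]], and
   its inverse [par i] on the closure [`[lo i, hi i]] of J_i. The two endpoints
   of an edge carry no preferred order; here the first is the one mapped to the
   left endpoint of J_i. *)
Record euclidean_graph (R : realType) := EuclideanGraph {
  vertices : {fset 'rV[R]_2};
  nedges : nat;
  edge : 'I_nedges -> {fset 'rV[R]_2};
  lo : 'I_nedges -> R;
  hi : 'I_nedges -> R;
  phi : 'I_nedges -> 'rV[R]_2 -> R;
  par : 'I_nedges -> R -> 'rV[R]_2;
  edges_simple : simple_graph vertices edge;
  edges_connected : connected_graph vertices edge;
  lo_lt_hi : forall i, lo i < hi i;
  par_endpoints : forall i, edge i = [fset par i (lo i); par i (hi i)]%fset;
  phi_lo : forall i, phi i (par i (lo i)) = lo i;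
  phi_hi : forall i, phi i (par i (hi i)) = hi i;
  par_diffeo : forall i, diffeo_onto_image (lo i) (hi i) (par i) (phi i)
}.

Section Network.
Variables (R : realType) (G : euclidean_graph R).

Definition is_tree : Prop := tree_graph (vertices G) (@edge R G).

(* Labelled points of the plane; the label [None] is the label 0 of vertices. *)
Definition lpoint : choiceType := (option 'I_(nedges G) * 'rV[R]_2)%type.

Definition network : set lpoint :=
  [set q : lpoint | match q.1 with
    | None => q.2 \in vertices G
    | Some i => (par i @` `]lo i, hi i[) q.2
    end].

(* The element of the network with coordinate t in the closure of J_i. *)
Definition at_coord (i : 'I_(nedges G)) (t : R) : lpoint :=
  if lo i < t < hi i then (Some i, par i t) else (None, par i t).

(* A segment (i, s, t) travels along edge i from coordinate s to coordinate t,
   without reversing. *)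
Definition segment : Type := ('I_(nedges G) * R * R)%type.
Definition seg_edge (g : segment) : 'I_(nedges G) := g.1.1.
Definition seg_start (g : segment) : lpoint := at_coord g.1.1 g.1.2.
Definition seg_end (g : segment) : lpoint := at_coord g.1.1 g.2.
Definition seg_length (g : segment) : R := `|g.2 - g.1.2|.

Definition valid_segment (g : segment) : bool :=
  [&& lo g.1.1 <= g.1.2 <= hi g.1.1, lo g.1.1 <= g.2 <= hi g.1.1
    & g.1.2 != g.2].

Definition nonoverlapping (g h : segment) : bool :=
  [|| seg_edge g != seg_edge h,
      Num.max g.1.2 g.2 <= Num.min h.1.2 h.2
    | Num.max h.1.2 h.2 <= Num.min g.1.2 g.2].

Definition is_vertex (p : lpoint) : bool := p.1 == None.

Definition joined_at_vertex (g h : segment) : bool :=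
  (seg_end g == seg_start h) && is_vertex (seg_end g).

Definition is_walk (p q : lpoint) (w : seq segment) : Prop :=
  [/\ all valid_segment w, sorted joined_at_vertex w,
      ohead (map seg_start w) = Some p & last p (map seg_end w) = q].

Definition is_path (p q : lpoint) (w : seq segment) : Prop :=
  [/\ is_walk p q w, pairwise nonoverlapping w
    & uniq (seq.filter is_vertex (p :: map seg_end w))].

Definition weight (w : seq segment) : R := \sum_(g <- w) seg_length g.

(* There are finitely many paths between two given points, and at least one
   between points of the network, so the infimum is a minimum. *)
Definition distG (p q : lpoint) : R :=
  if p == q then 0 else inf [set weight w | w in is_path p q].

Definition voronoi (x : lpoint) (X : {fset lpoint}) : set lpoint :=
  [set eta | network eta /\ {in X, forall x', distG eta x <= distG eta x'}].

Definition delaunay (X : {fset lpoint}) (x1 x2 : lpoint) : Prop :=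
  voronoi x1 X `&` voronoi x2 X !=set0.

Definition neighbours (Z X : {fset lpoint}) : set lpoint :=
  [set x | x \in X /\ exists2 z, z \in Z & delaunay X x z].

Definition clique (Y X : {fset lpoint}) : Prop :=
  {in Y &, forall y1 y2, delaunay X y1 y2}.

Definition chi (Y X : {fset lpoint}) : nat := `[< clique Y X >].

Definition general_position (X : {fset lpoint}) : Prop :=
  ~ exists c r x1 x2 x3,
      [/\ network c, 0 < r,
          [/\ x1 \in X, x2 \in X & x3 \in X],
          [/\ x1 != x2, x1 != x3 & x2 != x3]
        & [/\ distG c x1 = r, distG c x2 = r & distG c x3 = r]].

End Network.

Arguments network {R} G q.

(* Main.v *)
Require Import Defs.
From HB Require Import structures.
From mathcomp Require Import all_boot all_order all_algebra finmap.
From mathcomp Require Import all_classical all_reals all_analysis.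
From mathcomp Require Import lra.

Set Implicit Arguments.
Unset Strict Implicit.
Unset Printing Implicit Defensive.

Import Order.TTheory GRing.Theory Num.Theory.
Import numFieldNormedType.Exports.

Local Open Scope classical_set_scope.
Local Open Scope ring_scope.

(** On a tree network, removing edge [i] leaves two components, so every point
of the network has a projection onto edge [i]; the distance of two points is the
sum over the edges of the distances of their projections. Since two different
edges are always on one side of each other, this distance satisfies the
four-point condition, and it has midpoints.

Because of these two properties, [a] and [b] are Delaunay neighbours in [X] iff
no [x] in [X] has both [d x a < d a b] and [d x b < d a b]. General position
then forces cliques to have at most two points, and both consistency conditions
follow from the four-point condition. *)

(** * Preliminaries on sequences and on four points of the real line *)

Lemma map_mem_split (A : Type) (B : eqType) (f : A -> B) (s : seq A) (b : B) :
  b \in map f s -> exists s1 a s2, s = s1 ++ a :: s2 /\ f a = b.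
Proof.
elim: s => //= a s IHs; rewrite inE => /orP[/eqP->|/IHs[s1 [a' [s2 [-> <-]]]]].
  by exists [::], a, s.
by exists (a :: s1), a', s2.
Qed.

(** For four reals sorted as p, q, r, s, pairing p with r and q with s gives the same sum as pairing
    p with s and q with r, and the third pairing gives no more. So the largest of the three sums is
    attained twice. *)
Lemma four_point_line (R : realDomainType) (a b c d : R) :
  `|a - b| + `|c - d| <= Num.max (`|a - c| + `|b - d|) (`|a - d| + `|b - c|).
Proof.
rewrite le_max; apply/orP.
by case: (lerP a b); case: (lerP c d); case: (lerP a c); case: (lerP b d);
  case: (lerP a d); case: (lerP b c); intros; first [left; lra | right; lra].
Qed.

(** Identifying one of [a], [c] with one of [b], [d] turns the hypothesis into a violated triangle
    inequality or a strict inequality between equal sums. In [four_point] it is applied to the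
    projections onto one edge. *)
Lemma split_line_neq (R : realDomainType) (a b c d : R) :
  `|a - c| + `|b - d| < `|a - b| + `|c - d| ->
  [/\ a != b, a != d, c != b & c != d].
Proof.
move=> ltabcd; split; apply: contraTneq ltabcd => ->; rewrite -leNgt.
- by rewrite subrr normr0 add0r (distrC b c) ler_distD.
- by rewrite addrC (distrC c d) (distrC d b) addrC.
- by [].
- by rewrite subrr normr0 addr0 (distrC b d) ler_distD.
Qed.

Section TreeNetwork.
Variables (R : realType) (G : euclidean_graph R).
Implicit Types (i j k : 'I_(nedges G)) (p q m : lpoint G).
Implicit Types (g h : segment G) (w : seq (segment G)).

Let L := network G.

(** * Sides of an edge and projection onto it *)

Definition vlo i : 'rV[R]_2 := par i (lo i).
Definition vhi i : 'rV[R]_2 := par i (hi i).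

Lemma vlo_neq_vhi i : vlo i != vhi i.
Proof.
apply/eqP => /(congr1 (@phi R G i)); rewrite phi_lo phi_hi => e.
by have := lo_lt_hi i; rewrite e ltxx.
Qed.

Lemma adj_ends (a b : 'rV[R]_2) : adj (@edge R G) a b ->
  exists i, (a = vlo i /\ b = vhi i) \/ (a = vhi i /\ b = vlo i).
Proof.
move=> /existsP[i /eqP]; rewrite par_endpoints -/(vlo i) -/(vhi i) => ab.
exists i; have neq := vlo_neq_vhi i.
have: vlo i \in [fset a; b]%fset by rewrite -ab !inE eqxx.
have: vhi i \in [fset a; b]%fset by rewrite -ab !inE eqxx orbT.
rewrite !inE => /orP[]/eqP hib /orP[]/eqP lob; move: neq;
  rewrite hib lob ?eqxx //.
- by right.
- by left.
Qed.

Definition adj_minus i : rel 'rV[R]_2 :=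
  fun a b => [exists j, (j != i) && (edge j == [fset a; b]%fset)].

Lemma adj_minusC i a b : adj_minus i a b = adj_minus i b a.
Proof. by apply: eq_existsb => j; rewrite fsetUC. Qed.

Lemma adj_minusW i : subrel (adj_minus i) (adj (@edge R G)).
Proof. by move=> a b /existsP[j /andP[_ jab]]; apply/existsP; exists j. Qed.

Definition hi_side i (a : 'rV[R]_2) : Prop :=
  exists2 s, path (adj_minus i) (vhi i) s & last (vhi i) s = a.

Lemma hi_side_adj i a b : adj_minus i a b -> hi_side i a -> hi_side i b.
Proof.
move=> iab [s hs la]; exists (rcons s b); last by rewrite last_rcons.
by rewrite rcons_path hs la.
Qed.

Lemma hi_side_edge i j : j != i -> hi_side i (vlo j) <-> hi_side i (vhi j).
Proof.
move=> ji; have jE : adj_minus i (vlo j) (vhi j).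
  by apply/existsP; exists j; rewrite ji par_endpoints eqxx.
split; apply: hi_side_adj => //; by rewrite adj_minusC.
Qed.

(** In a tree, this is the endpoint of edge [i] at which every walk from the vertex [a] first meets
    that edge. *)
Definition vproj i (a : 'rV[R]_2) : R :=
  if `[< hi_side i a >] then hi i else lo i.

Lemma vproj_edge i j : j != i -> vproj i (vlo j) = vproj i (vhi j).
Proof. by move=> ji; rewrite /vproj (asbool_equiv_eq (hi_side_edge ji)). Qed.

Lemma vproj_hi i : vproj i (vhi i) = hi i.
Proof. by rewrite /vproj asboolT //; exists [::]. Qed.

(* The coordinate of the point of edge [i] that is nearest to [p]. *)
Definition proj i p : R :=
  match p.1 with
  | None => vproj i p.2
  | Some j => if j == i then phi j p.2 else vproj i (vlo j)
  end.

Lemma proj_at_coord_neq i j t : lo j <= t <= hi j -> j != i ->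
  proj i (at_coord j t) = vproj i (vlo j).
Proof.
move=> /andP[lot thi] ji; rewrite /proj /at_coord.
case: ltP => [_|tlo] /=; last first.
  by have -> : t = lo j by apply/le_anti; rewrite tlo lot.
case: ltP => [_|hit] /=; first by rewrite (negPf ji).
have -> : t = hi j by apply/le_anti; rewrite hit thi.
by rewrite (vproj_edge ji).
Qed.

Lemma at_coord_network i t : lo i <= t <= hi i -> L (at_coord i t).
Proof.
have [_ sE] := edges_simple G; have [Ei _] := sE i.
move=> /andP[lot thi]; rewrite /L /network /at_coord /=.
case: ltP => [lot'|tlo] /=; last first.
  have -> : t = lo i by apply/le_anti; rewrite tlo lot.
  by apply: (fsubsetP Ei); rewrite par_endpoints !inE eqxx.
case: ltP => [thi'|hit] /=; first by exists t; rewrite //= in_itv /= lot'.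
have -> : t = hi i by apply/le_anti; rewrite hit thi.
by apply: (fsubsetP Ei); rewrite par_endpoints !inE eqxx orbT.
Qed.

Lemma at_coord_lo i : at_coord i (lo i) = (None, vlo i).
Proof. by rewrite /at_coord ltxx. Qed.

Lemma at_coord_hi i : at_coord i (hi i) = (None, vhi i).
Proof. by rewrite /at_coord ltxx andbF. Qed.

(** A closed form of [distG] on a tree, without walks or infimum. Symmetry and the triangle
    inequality hold edge by edge; positivity needs paths and comes with [treedist_gt0]. *)
Definition treedist p q : R := \sum_i `|proj i p - proj i q|.

Lemma treedistC p q : treedist p q = treedist q p.
Proof. by apply: eq_bigr => i _; rewrite distrC. Qed.

Lemma treedist_triangle m p q : treedist p q <= treedist p m + treedist m q.
Proof. by rewrite -big_split; apply: ler_sum => i _; apply: ler_distD. Qed.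

Lemma treedistxx p : treedist p p = 0.
Proof. by rewrite /treedist big1 // => i _; rewrite subrr normr0. Qed.

Lemma treedist_ge0 p q : 0 <= treedist p q.
Proof. by apply: sumr_ge0. Qed.

(** * Chains of segments, and connectedness of the network *)

(** A walk made recursive for induction: joints may lie inside an edge, and the empty chain joins a
    point to itself. *)
Fixpoint chain p w q : Prop :=
  if w is g :: w' then
    [/\ valid_segment g, seg_start g = p & chain (seg_end g) w' q]
  else p = q.

Lemma chain_cat p w1 w2 q :
  chain p (w1 ++ w2) q <-> exists2 m, chain p w1 m & chain m w2 q.
Proof.
elim: w1 p => [|g w1 IHw] p /=; first by split=> [|[m ->]//]; exists p.
split=> [[vg sg /IHw[m ? ?]]|[m [vg sg ?] ?]]; first by exists m.
by split => //; apply/IHw; exists m.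
Qed.

Lemma weight_cons g w : weight (g :: w) = seg_length g + weight w.
Proof. by rewrite /weight big_cons. Qed.

Lemma weight_ge0 w : 0 <= weight w.
Proof. by apply: sumr_ge0 => g _; apply: normr_ge0. Qed.

Lemma valid_segment_length g : valid_segment g -> 0 < seg_length g.
Proof. by case/and3P=> _ _; rewrite /seg_length normr_gt0 subr_eq0 eq_sym. Qed.

Lemma chain_weight_gt0 p g w q : chain p (g :: w) q -> 0 < weight (g :: w).
Proof.
case=> vg _ _; rewrite weight_cons ltr_wpDr ?weight_ge0 //.
exact: valid_segment_length.
Qed.

Lemma weight_edges w :
  weight w = \sum_i \sum_(g <- w | seg_edge g == i) seg_length g.
Proof. by rewrite /weight (partition_big (@seg_edge R G) predT). Qed.

(** The condition on joints that [chain] leaves out; the first segment may start anywhere. *)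
Definition inner_vertices w : bool :=
  all (fun g => is_vertex (seg_start g)) (behead w).

Lemma chain_sorted p w q : chain p w q -> inner_vertices w ->
  sorted (@joined_at_vertex R G) w.
Proof.
case: w => // g w [_ _ gw]; rewrite /inner_vertices /=.
elim: w g gw => //= h w IHw g [_ gh hw] /andP[vh vw].
by rewrite IHw // /joined_at_vertex -gh eqxx vh.
Qed.

Lemma walk_chain p q w : is_walk p q w -> chain p w q.
Proof.
case; elim: w p => [|g w IHw] p //= /andP[vg vw] gw [<-] lq; split => //.
case: w IHw vw gw lq => //= h w IHw vhw /andP[/andP[/eqP gh _] hw] lq.
by apply: IHw => //=; rewrite gh.
Qed.

Lemma chain_last p q w : chain p w q -> last p (map (@seg_end R G) w) = q.
Proof. by elim: w p => //= g w IHw p [_ _ /IHw]. Qed.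

Lemma chain_valid p q w : chain p w q -> all (@valid_segment R G) w.
Proof. by elim: w p => //= g w IHw p [-> _ /IHw]. Qed.

(** The clause [t != lo i] makes the segment between the point and [vlo i] valid. *)
Lemma at_coordP i x : L (Some i, x) ->
  exists t, [/\ lo i <= t <= hi i, t != lo i & (Some i, x) = at_coord i t].
Proof.
case=> t; rewrite /= in_itv /= => /andP[lot thi] <-; exists t.
by rewrite /at_coord lot thi !ltW //; split => //; rewrite gt_eqF.
Qed.

Lemma vertex_chain a b : a \in vertices G -> b \in vertices G ->
  exists2 w, chain (None, a) w (None, b)
    & all (fun g => is_vertex (seg_start g)) w.
Proof.
move=> aV bV; have [s] := edges_connected aV bV.
elim: s a {aV} => [|c s IHs] a /=; first by move=> _ ->; exists [::].
case/andP=> /adj_ends[i ac] cs cb; have [w cw vw] := IHs _ cs cb.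
have lohi := lo_lt_hi i; have lohi' := ltW lohi.
case: ac => -[-> ec]; subst c.
  exists ((i, lo i, hi i) :: w) => /=; last first.
    by rewrite vw /seg_start at_coord_lo.
  split; rewrite /seg_start /seg_end /= ?at_coord_lo ?at_coord_hi //.
  by rewrite /valid_segment /= !lexx lohi' lt_eqF.
exists ((i, hi i, lo i) :: w) => /=; last first.
  by rewrite vw /seg_start at_coord_hi.
split; rewrite /seg_start /seg_end /= ?at_coord_lo ?at_coord_hi //.
by rewrite /valid_segment /= !lexx lohi' gt_eqF.
Qed.

Lemma network_chain p q : L p -> L q ->
  exists2 w, chain p w q & inner_vertices w.
Proof.
have vlo_V i : vlo i \in vertices G.
  have /= := @at_coord_network i (lo i).
  by rewrite at_coord_lo; apply; rewrite lexx ltW ?lo_lt_hi.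
(* The bound on the size leaves at most one segment before the first vertex; it heads the
   concatenated chain, where [inner_vertices] does not test its start. *)
have from p' : L p' -> exists2 a, a \in vertices G &
    exists2 w, chain p' w (None, a) & (size w <= 1)%N.
  case: p' => [[i|] x] Lp'; last by exists x => //; exists [::].
  have [t [it tlo ->]] := at_coordP Lp'; exists (vlo i) => //.
  exists [:: (i, t, lo i)] => //=; split=> //; last exact: at_coord_lo.
  by rewrite /valid_segment /= it lexx ltW ?lo_lt_hi.
have to q' : L q' -> exists2 b, b \in vertices G &
    exists2 w, chain (None, b) w q' & all (fun g => is_vertex (seg_start g)) w.
  case: q' => [[i|] x] Lq'; last by exists x => //; exists [::].
  have [t [it tlo ->]] := at_coordP Lq'; exists (vlo i) => //.
  have st : seg_start (i, lo i, t) = (None, vlo i) by apply: at_coord_lo.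
  exists [:: (i, lo i, t)]; last by rewrite /= st.
  split=> //=; rewrite /valid_segment /= it lexx eq_sym tlo ltW ?lo_lt_hi//.
move=> /from[a aV [w1 c1 s1]] /to[b bV [w3 c3 v3]].
have [w2 c2 v2] := vertex_chain aV bV.
exists (w1 ++ w2 ++ w3).
  apply/chain_cat; exists (None, a) => //.
  by apply/chain_cat; exists (None, b).
rewrite /inner_vertices.
have v23 : all (fun g => is_vertex (seg_start g)) (w2 ++ w3).
  by rewrite all_cat v2.
case: w1 s1 {c1} => [|g [|]] // _; rewrite /= ?drop0 //.
by move: v23; case: (w2 ++ w3) => //= g w /andP[].
Qed.

(* A chain that visits an edge twice can be shortcut along that edge. *)
Lemma simple_chain p w q : chain p w q -> inner_vertices w ->
  exists w', [/\ chain p w' q, inner_vertices w'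
    & uniq (map (@seg_edge R G) w')].
Proof.
elim: w p => [|g w IHw] p; first by exists [::].
move=> [vg sg gw]; rewrite /inner_vertices /= => vw.
case: w IHw gw vw => [_ gq _|h0 w0 IHw gw vw]; first by exists [:: g].
have [gh0 vh0] : seg_start h0 = seg_end g /\ is_vertex (seg_start h0).
  by case: gw => _ <- _; case/andP: vw.
have [|w [{}gw iw uw]] := IHw _ gw; first by case/andP: vw.
have {IHw}vw : all (fun g => is_vertex (seg_start g)) w.
  case: w gw iw {uw} => //= h w [_ -> _]; rewrite /inner_vertices /= => ->.
  by rewrite -gh0 vh0.
have [gw'|gNw] := boolP (seg_edge g \in map (@seg_edge R G) w); last first.
  by exists (g :: w); split=> //=; rewrite gNw.
have [b [h [c [ew gh]]]] := map_mem_split gw'.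
move: gw uw vw; rewrite ew => /chain_cat[m _ [vh _ hc]].
rewrite map_cat cat_uniq all_cat /= => /and3P[_ _ /andP[hNc uc]] /and3P[_ _ vc].
have [i s] : exists i, seg_edge g = i by exists (seg_edge g).
have gE : g = (i, g.1.2, g.2) by rewrite -s; case: (g) => -[].
have hE : h = (i, h.1.2, h.2) by rewrite -s -gh; case: (h) => -[].
(* If [g] starts where [h] ends, the shortcut would be a degenerate, hence invalid, segment; the
   remainder [c] alone is then the chain. *)
have [gh2|gh2] := eqVneq g.1.2 h.2.
  exists c; split=> //; last first.
    by move: vc; rewrite /inner_vertices; case: (c) => //= ? ? /andP[].
  by rewrite -sg gE /seg_start /= gh2 hE in hc *.
exists ((i, g.1.2, h.2) :: c); split=> //=; last by rewrite uc andbT -s -gh.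
split; last by rewrite hE in hc.
  move: vg vh; rewrite gE hE => /and3P[/= g1 g2 _] /and3P[/= h1 h2 _].
  by rewrite /valid_segment /= g1 h2.
by rewrite -sg gE.
Qed.

(** * Shortest paths in a tree *)

Hypothesis tree_G : is_tree G.

(** This is where acyclicity enters. A duplicate-free path from [vhi i] to [vlo i] avoiding edge [i]
    closes up through edge [i] to a cycle. With at most two vertices, it would need a second edge
    with the ends of edge [i], which simplicity excludes. *)
Lemma vproj_lo i : vproj i (vlo i) = lo i.
Proof.
rewrite /vproj asboolF // => -[s0 hs0 ls0]; have [_ acyc] := tree_G.
have [inj_E _] := edges_simple G.
case/shortenP: hs0 ls0 => s hs us _ ls; have iE := par_endpoints i.
have cyc : cycle (adj (@edge R G)) (vhi i :: s).
  rewrite /= rcons_path (sub_path (@adj_minusW i) hs) ls /=.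
  by apply/existsP; exists i; rewrite iE eqxx.
move: hs ls us (acyc _ us cyc); case: s {cyc} => [_ /= hl|a [|//]].
  by move: (vlo_neq_vhi i); rewrite hl eqxx.
move=> /andP[/existsP[j /andP[ji /eqP jE]] _] /= al _ _.
case/eqP: ji; apply: inj_E; rewrite iE jE al fsetUC //.
Qed.

Lemma proj_at_coord i t : lo i <= t <= hi i -> proj i (at_coord i t) = t.
Proof.
move=> /andP[lot thi]; rewrite /proj /at_coord.
have [canc _ _] := par_diffeo i.
case: ltP => [lot'|tlo] /=; last first.
  have -> : t = lo i by apply/le_anti; rewrite tlo lot.
  exact: vproj_lo.
case: ltP => [thi'|hit] /=.
  by rewrite eqxx canc // in_itv /= lot' thi'.
have -> : t = hi i by apply/le_anti; rewrite hit thi.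
exact: vproj_hi.
Qed.

Lemma proj_segment i g : valid_segment g ->
  `|proj i (seg_start g) - proj i (seg_end g)| =
  if seg_edge g == i then seg_length g else 0.
Proof.
case: g => [[j s] t] /and3P[/= js jt _].
rewrite /seg_start /seg_end /seg_length /seg_edge /=; case: eqVneq => [<-|ji].
  by rewrite !proj_at_coord // distrC.
by rewrite !proj_at_coord_neq // subrr normr0.
Qed.

(** A segment moves only the projection onto its own edge, by its length; the triangle inequality
    adds up these moves. *)
Lemma chain_proj_le i p w q : chain p w q ->
  `|proj i p - proj i q| <= \sum_(g <- w | seg_edge g == i) seg_length g.
Proof.
elim: w p => [p ->|g w IHw p [vg <- /IHw IH]].
  by rewrite big_nil subrr normr0.
rewrite big_cons (le_trans (ler_distD (proj i (seg_end g)) _ _)) //.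
rewrite proj_segment //; case: ifP => _; first by rewrite lerD2l.
by rewrite add0r.
Qed.


Lemma treedist_le_weight p w q : chain p w q -> treedist p q <= weight w.
Proof.
move=> cw; rewrite weight_edges; apply: ler_sum => i _; exact: chain_proj_le.
Qed.

(** With all edges different, at most one segment moves the projection onto edge [i], so nothing is
    lost in the triangle inequality. *)
Lemma simple_chain_proj i p w q : chain p w q -> uniq (map (@seg_edge R G) w) ->
  `|proj i p - proj i q| = \sum_(g <- w | seg_edge g == i) seg_length g.
Proof.
elim: w p => [p ->|g w IHw p [vg <- cw] /= /andP[gNw uw]].
  by rewrite big_nil subrr normr0.
rewrite big_cons; case: (eqVneq (seg_edge g) i) => [gi|gi]; last first.
  have := proj_segment i vg; rewrite (negPf gi) => /eqP.
  by rewrite normr_eq0 subr_eq0 => /eqP ->; apply: IHw.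
have w0 : \sum_(h <- w | seg_edge h == i) seg_length h = 0.
  rewrite big_hasC //; apply: contra gNw.
  by rewrite gi -has_pred1 has_map.
have := proj_segment i vg; rewrite gi eqxx w0 addr0 => <-.
have /eqP := IHw _ cw uw; rewrite w0 normr_eq0 subr_eq0 => /eqP -> //.
Qed.

Lemma simple_chain_weight p w q : chain p w q ->
  uniq (map (@seg_edge R G) w) -> weight w = treedist p q.
Proof.
move=> cw uw; rewrite weight_edges; apply: eq_bigr => i _.
by rewrite (simple_chain_proj i cw uw).
Qed.

(** A return to [p] would give a nonempty chain from [p] to [p] with different edges: its weight is
    positive, yet equal to [treedist p p]. *)
Lemma simple_chain_uniq p w q : chain p w q -> uniq (map (@seg_edge R G) w) ->
  uniq (p :: map (@seg_end R G) w).
Proof.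
elim: w p => //= g w IHw p [vg sg gw] /= /andP[gNw uw].
rewrite (IHw _ gw uw) andbT.
apply/negP => /(@map_mem_split _ _ _ (g :: w))[w1 [h [w2 [ew hp]]]].
have cw : chain p (g :: w) q by [].
have ug : uniq (map (@seg_edge R G) (g :: w)) by rewrite /= gNw.
move: cw ug; rewrite ew -cat_rcons => /chain_cat[m c1 _].
rewrite map_cat cat_uniq => /andP[u1 _].
have em : m = p by rewrite -(chain_last c1) map_rcons last_rcons.
have := simple_chain_weight c1 u1; rewrite em treedistxx => /eqP.
case: w1 {ew u1} c1 => [|h1 w1] c1; by rewrite gt_eqF // (chain_weight_gt0 c1).
Qed.

Lemma network_simple_chain p q : L p -> L q ->
  exists w, [/\ chain p w q, inner_vertices w & uniq (map (@seg_edge R G) w)].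
Proof.
by move=> Lp Lq; have [w] := network_chain Lp Lq; apply: simple_chain.
Qed.

Lemma simple_chain_path p w q : p != q -> chain p w q -> inner_vertices w ->
  uniq (map (@seg_edge R G) w) -> is_path p q w.
Proof.
move=> pq cw iw uw; split.
- split; [exact: chain_valid cw| exact: chain_sorted cw iw| |exact: chain_last].
  by case: w cw {iw uw} => /= [/eqP|g w [_ <-]]; first by rewrite (negPf pq).
- move: uw; rewrite uniq_pairwise pairwise_map; apply: sub_pairwise => g h /= gh.
  by rewrite /nonoverlapping gh.
- exact: filter_uniq (simple_chain_uniq cw uw).
Qed.

(** [treedist] bounds the weight of every path from below, and a chain with different edges is a
    path attaining it. *)
Lemma distG_treedist p q : L p -> L q -> distG p q = treedist p q.
Proof.
move=> Lp Lq; rewrite /distG; case: eqVneq => [->|pq].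
  by rewrite treedistxx.
have [w [cw iw uw]] := network_simple_chain Lp Lq.
have lb : lbound [set weight w | w in is_path p q] (treedist p q).
  by move=> _ [w' [/walk_chain /treedist_le_weight ? _ _] <-].
have mem : [set weight w | w in is_path p q] (treedist p q).
  by exists w; [exact: simple_chain_path|exact: simple_chain_weight].
apply/le_anti/andP; split; first by apply: ge_inf => //; exists (treedist p q).
by apply: lb_le_inf => //; exists (treedist p q).
Qed.

Lemma treedist_gt0 p q : L p -> L q -> p != q -> 0 < treedist p q.
Proof.
move=> Lp Lq pq; have [w [cw _ uw]] := network_simple_chain Lp Lq.
rewrite -(simple_chain_weight cw uw).
case: w cw {uw} => [/= /eqP|g w]; first by rewrite (negPf pq).
exact: chain_weight_gt0.
Qed.

(** * Midpoints and the four-point condition *)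

(** Follow the chain until weight [t] is used up. The two inequalities suffice: on a chain of weight
    [treedist p q] the triangle inequality makes them equalities. *)
Lemma chain_point p w q t : L p -> chain p w q -> 0 <= t <= weight w ->
  exists m, [/\ L m, treedist p m <= t & treedist m q <= weight w - t].
Proof.
elim: w p t => [|g w IHw] p t Lp.
  by move=> <-; rewrite {1}/weight big_nil -eq_le => /eqP <-; exists p;
     rewrite treedistxx /weight big_nil subr0.
case: g => [[i a] b] [vg <- cw]; have /and3P[/= ia ib ab] := vg.
have Le : L (at_coord i b) by apply: at_coord_network.
have end1 s1 s2 : lo i <= s1 <= hi i -> lo i <= s2 <= hi i ->
    treedist (at_coord i s1) (at_coord i s2) <= `|s1 - s2|.
  move=> is1 is2.
  rewrite /treedist (bigD1 i) //= !proj_at_coord // big1 ?addr0 //.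
  by move=> j ji; rewrite !proj_at_coord_neq // 1?eq_sym // subrr normr0.
rewrite weight_cons /seg_length /= /seg_start /= => /andP[t0 tw].
have [tba|bat] := leP t `|b - a|.
  have [r [ir ar rb]] : exists r, [/\ lo i <= r <= hi i, `|a - r| <= t &
      `|r - b| <= `|b - a| - t].
    case: (lerP a b) tba => ab' tba; [exists (a + t)|exists (a - t)]; split.
    - by lra.
    - by rewrite ler_norml; lra.
    - by rewrite ler_norml; lra.
    - by lra.
    - by rewrite ler_norml; lra.
    - by rewrite ler_norml; lra.
  exists (at_coord i r); split; first exact: at_coord_network.
    exact: le_trans (end1 _ _ _ _) ar.
  apply: (le_trans (treedist_triangle (at_coord i b) _ _)).
  have := end1 _ _ ir ib; have := treedist_le_weight cw.
  rewrite /seg_end /=; lra.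
have [|m [Lm dm mq]] := IHw _ (t - `|b - a|) Le cw; first by lra.
exists m; split => //.
  apply: (le_trans (treedist_triangle (at_coord i b) _ _)).
  by have := end1 _ _ ia ib; rewrite distrC; move: dm; rewrite /seg_end /=; lra.
by move: mq; lra.
Qed.

Lemma midpoint p q : L p -> L q -> exists m,
  [/\ L m, treedist m p = treedist p q / 2 & treedist m q = treedist p q / 2].
Proof.
move=> Lp Lq; have [w [cw _ uw]] := network_simple_chain Lp Lq.
have wE := simple_chain_weight cw uw; have d0 := treedist_ge0 p q.
have [|m [Lm pm mq]] := @chain_point p w q (treedist p q / 2) Lp cw.
  by rewrite wE; lra.
exists m; have := treedist_triangle m p q; rewrite wE (treedistC p m) in pm mq *.
by split=> //; lra.
Qed.

(* Edge [j] lies on one side of edge [i] and conversely, so no point projects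
   away from the other edge in both. *)
Lemma proj_compatible i j : i != j -> exists e e', forall p, L p ->
  proj i p = e \/ proj j p = e'.
Proof.
move=> ij; exists (vproj i (vlo j)), (vproj j (vlo i)) => p Lp.
have lohi := lo_lt_hi i.
have Llo : L (at_coord i (lo i)) by apply: at_coord_network; rewrite lexx ltW.
have [w cw _] := network_chain Llo Lp.
have : proj i (at_coord i (lo i)) = vproj i (vlo j) \/
       proj j (at_coord i (lo i)) = vproj j (vlo i).
  by right; rewrite at_coord_lo.
(* The disjunction is carried along a chain from an end of edge [i]: on edge [i] the second
   alternative holds, on edge [j] the first, and a segment of any other edge changes neither
   projection. *)
elim: w (at_coord i (lo i)) cw {Llo} => [_ -> //|[[k a] b] w IHw _ [vg <- cw] H].
apply: IHw cw _; have /and3P[/= ka kb _] := vg.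
move: H; rewrite /seg_start /seg_end /=.
have [ki|ki] := eqVneq k i; first by right; rewrite proj_at_coord_neq ki // -ki.
have [kj|kj] := eqVneq k j; last by rewrite !proj_at_coord_neq.
by left; rewrite proj_at_coord_neq kj // 1?eq_sym // -kj.
Qed.

(** A failure is witnessed by an edge [i] whose projections keep [a], [c] apart from [b], [d], and
    an edge [j] whose projections keep [a], [d] apart from [b], [c]. If [i = j], the line is
    contradicted. Otherwise [e] is missed on edge [i] by both points of one of the pairs [a], [c]
    and [b], [d]; both then project to [e'] on edge [j], which keeps them apart. *)
Lemma four_point a b c d : L a -> L b -> L c -> L d ->
  treedist a b + treedist c d <=
  Num.max (treedist a c + treedist b d) (treedist a d + treedist b c).
Proof.
move=> La Lb Lc Ld; rewrite leNgt gt_max; apply/negP => /andP[].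
have strict (F1 F2 : 'I_(nedges G) -> R) :
    \sum_i F1 i < \sum_i F2 i -> exists i, F1 i < F2 i.
  move=> F12; apply: contrapT => /forallNP H; move: F12; apply/negP.
  by rewrite -leNgt; apply: ler_sum => i _; rewrite leNgt; apply/negP.
rewrite /treedist -!big_split => /strict[i /= si] /strict[j /= sj].
have [ij|ij] := eqVneq i j.
  have := four_point_line (proj i a) (proj i b) (proj i c) (proj i d).
  by rewrite leNgt gt_max si ij sj.
have [/eqP ab_i /eqP ad_i /eqP cb_i /eqP cd_i] := split_line_neq si.
have [|/eqP ab_j /eqP ac_j /eqP db_j /eqP dc_j] :=
    @split_line_neq _ (proj j a) (proj j b) (proj j d) (proj j c).
  by rewrite (distrC (proj j d)).
have [e [e' ee']] := proj_compatible ij.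
by have [] := ee' _ La; have [] := ee' _ Lb; have [] := ee' _ Lc;
  have [] := ee' _ Ld; congruence.
Qed.

(** * Delaunay neighbours and cliques in terms of [treedist] *)

(** A common point [c] of the cells is equidistant from [a] and [b], and no [x] is nearer to it; the
    four-point condition for [c], [x], [a], [b] gives the inequality. Conversely, the midpoint of
    [a] and [b] lies in both cells. *)
Lemma delaunayP (X : {fset lpoint G}) a b : [set` X] `<=` L ->
  a \in X -> b \in X ->
  delaunay X a b <->
  {in X, forall x, treedist a b <= Num.max (treedist x a) (treedist x b)}.
Proof.
move=> XL aX bX; have La := XL _ aX; have Lb := XL _ bX; split.
  move=> [c [[Lc ca] [_ cb]]] x xX; have Lx := XL _ xX.
  have := ca _ bX; have := cb _ aX; have := ca _ xX.
  rewrite !distG_treedist // => cax cba cab.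
  rewrite leNgt gt_max; apply/negP => /andP[xa xb].
  have := four_point Lc Lx La Lb; rewrite leNgt gt_max => /negP; apply.
  by apply/andP; split; lra.
move=> abX; have [m [Lm ma mb]] := midpoint La Lb.
have far x : x \in X -> treedist a b / 2 <= treedist m x.
  move=> xX; have := abX _ xX; rewrite le_max.
  have := treedist_triangle m x a; have := treedist_triangle m x b.
  by rewrite ma mb (treedistC x m) => ? ? /orP[]; lra.
exists m; split; split=> // x xX; have Lx := XL _ xX;
  by rewrite !distG_treedist // ?ma ?mb far.
Qed.

(* The midpoint of [a] and [b] is also at distance [treedist a b / 2] from [c]. *)
Lemma isosceles_general_position (X : {fset lpoint G}) a b c :
  [set` X] `<=` L -> general_position X -> a \in X -> b \in X -> c \in X ->
  a != b -> a != c -> b != c -> treedist a b = treedist a c ->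
  treedist b c <= treedist a b -> False.
Proof.
move=> XL gp aX bX cX ab ac bc abac bcab; apply: gp.
have La := XL _ aX; have Lb := XL _ bX; have Lc := XL _ cX.
have [m [Lm ma mb]] := midpoint La Lb; have ab0 := treedist_gt0 La Lb ab.
exists m, (treedist a b / 2), a, b, c.
split=> //; first by lra.
rewrite !distG_treedist //; split=> //; apply/le_anti/andP; split.
  have := four_point Lm Lc La Lb.
  rewrite le_max ma mb (treedistC c b) (treedistC c a).
  by case/orP; lra.
by have := treedist_triangle m a c; rewrite (treedistC a m) ma; lra.
Qed.

(** For three pairwise neighbours no side exceeds both others, so the two longest sides are equal
    and [isosceles_general_position] applies at their common end. *)
Lemma clique_general_position (X Y : {fset lpoint G}) a b c :
  [set` X] `<=` L -> general_position X -> (Y `<=` X)%fset -> clique Y X ->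
  a \in Y -> b \in Y -> c \in Y -> a != b -> c = a \/ c = b.
Proof.
move=> XL gp /fsubsetP YX cl aY bY cY ab.
have [aX bX cX] := And3 (YX _ aY) (YX _ bY) (YX _ cY).
have [ca|ca] := eqVneq c a; first by left.
have [cb|cb] := eqVneq c b; first by right.
have /(_ _ cX) := (delaunayP XL aX bX).1 (cl _ _ aY bY).
have /(_ _ bX) := (delaunayP XL aX cX).1 (cl _ _ aY cY).
have /(_ _ aX) := (delaunayP XL bX cX).1 (cl _ _ bY cY).
rewrite (treedistC b a) (treedistC c a) (treedistC c b) !le_max.
move=> bc_max ac_max ab_max; exfalso.
have [[e l]|[e l]|[e l]] :
    [\/ treedist a b = treedist a c /\ treedist b c <= treedist a b,
        treedist a b = treedist b c /\ treedist a c <= treedist a b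
      | treedist a c = treedist b c /\ treedist a b <= treedist a c].
- case/orP: bc_max; case/orP: ac_max; case/orP: ab_max => *;
    by first [apply: Or31; split; lra | apply: Or32; split; lra
             | apply: Or33; split; lra].
- by apply: (isosceles_general_position XL gp aX bX cX) => //; rewrite eq_sym.
- apply: (isosceles_general_position XL gp bX aX cX);
    by rewrite // 1?eq_sym // (treedistC b a).
- apply: (isosceles_general_position XL gp cX aX bX) => //;
    by rewrite (treedistC c a) // (treedistC c b).
Qed.

Lemma subset_general_position (X Y : {fset lpoint G}) : (Y `<=` X)%fset ->
  general_position X -> general_position Y.
Proof.
move=> /fsubsetP YX gp [c [r [a [b [e [Lc r0 [aY bY eY] ne eq]]]]]]; apply: gp.
by exists c, r, a, b, e; split=> //; split; apply: YX.
Qed.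

Lemma subset_delaunay (X Y : {fset lpoint G}) a b : (Y `<=` X)%fset ->
  delaunay X a b -> delaunay Y a b.
Proof.
move=> /fsubsetP YX [c [[Lc ca] [_ cb]]]; exists c.
by split; split=> // x /YX; [apply: ca | apply: cb].
Qed.

Lemma subset_clique (X Y Z : {fset lpoint G}) : (Y `<=` X)%fset ->
  clique Z X -> clique Z Y.
Proof. by move=> YX cl a b aZ bZ; apply: subset_delaunay YX (cl a b aZ bZ). Qed.

(** * Points obstructing a Delaunay relation *)

(** [x] lies in the lune of [a] and [b], so by [delaunay_closer] the Delaunay graph is the relative
    neighbourhood graph. *)
Definition closer x a b : Prop :=
  treedist x a < treedist a b /\ treedist x b < treedist a b.

Lemma closerC x a b : closer x a b -> closer x b a.
Proof. by case=> xa xb; rewrite /closer (treedistC b a). Qed.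

Lemma closer_neq x a b : closer x a b -> a != b.
Proof.
case=> xa _; apply: contraTneq xa => ->.
by rewrite treedistxx -leNgt treedist_ge0.
Qed.

Lemma not_closer_self a b : ~ closer a a b.
Proof. by case=> _; rewrite ltxx. Qed.

(** Used with [c] a new point: an old point obstructing its relation to [a] would already have
    obstructed the relation of [a] and [b]. *)
Lemma closer_left c x a b : L a -> L b -> L c -> L x ->
  closer c a b -> closer x a c -> closer x a b.
Proof.
move=> La Lb Lc Lx [ca cb] [xa xc]; rewrite (treedistC a c) in xa xc.
split; first by lra.
have := four_point Lx Lb Lc La; rewrite le_max (treedistC b a) (treedistC b c).
by case/orP; lra.
Qed.

(** The same for two new points [c], [e] obstructing one pair: it shows that they are neighbours. *)
Lemma closer_between c e x a b : L a -> L b -> L c -> L e -> L x ->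
  closer c a b -> closer e a b -> closer x c e -> closer x a b.
Proof.
move=> La Lb Lc Le Lx [ca cb] [ea eb] [xc xe].
split.
  have := four_point Lx La Lc Le; rewrite le_max (treedistC a c) (treedistC a e).
  by case/orP; lra.
have := four_point Lx Lb Lc Le; rewrite le_max (treedistC b c) (treedistC b e).
by case/orP; lra.
Qed.

Lemma delaunay_closer (X : {fset lpoint G}) a b : [set` X] `<=` L ->
  a \in X -> b \in X ->
  delaunay X a b <-> {in X, forall x, ~ closer x a b}.
Proof.
move=> XL aX bX; rewrite (delaunayP XL aX bX).
split=> H x /H; rewrite leNgt gt_max.
  by move=> /negP nab [xa xb]; apply: nab; rewrite xa.
by move=> nab; apply/negP => /andP.
Qed.

Lemma not_clique (X Y : {fset lpoint G}) : [set` X] `<=` L -> (Y `<=` X)%fset ->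
  ~ clique Y X ->
  exists a b x, [/\ a \in Y, b \in Y, x \in X & closer x a b].
Proof.
move=> XL /fsubsetP YX ncl; apply: contrapT => H; apply: ncl => a b aY bY.
apply/delaunay_closer; rewrite ?YX // => x xX xab.
by apply: H; exists a, b, x.
Qed.

Lemma clique_closer (X Y : {fset lpoint G}) a b x : [set` X] `<=` L ->
  (Y `<=` X)%fset -> clique Y X -> a \in Y -> b \in Y -> x \in X ->
  ~ closer x a b.
Proof.
move=> XL /fsubsetP YX cl aY bY.
by apply: (delaunay_closer XL (YX _ aY) (YX _ bY)).1; apply: cl.
Qed.

Lemma network_fset1U (X : {fset lpoint G}) a : L a -> [set` X] `<=` L ->
  [set` (a |` X)%fset] `<=` L.
Proof. by move=> La XL x; rewrite /= in_fset1U => /predU1P[->|/XL]. Qed.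

(** An obstructing point in [z] would contradict the clique in [z], so it is [u] itself. *)
Lemma clique_destroyed (z y : {fset lpoint G}) u : [set` z] `<=` L -> L u ->
  (y `<=` z)%fset -> clique y z -> ~ clique y (u |` z)%fset ->
  exists a b, [/\ a \in y, b \in y & closer u a b].
Proof.
move=> zL Lu yz clz /not_clique.
case; [exact: network_fset1U|exact: fsubset_trans yz (fsubsetU1 _ _)|].
move=> a [b [x [ay by_]]]; rewrite in_fset1U => /predU1P[->|xz] xab.
  by exists a, b.
by case: (clique_closer zL yz clz ay by_ xz).
Qed.

(** By general position [y] consists of the two points that [u] obstructs, and [closer_left] makes
    each of them a neighbour of [u]. *)
Lemma destroyed_neighbours (z y : {fset lpoint G}) u : [set` z] `<=` L -> L u ->
  (y `<=` z)%fset -> general_position z ->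
  clique y z -> ~ clique y (u |` z)%fset ->
  [set` y] `<=` neighbours [fset u]%fset (u |` z)%fset.
Proof.
move=> zL Lu yz gp clz nclu c cy.
have [a [b [ay by_ uab]]] := clique_destroyed zL Lu yz clz nclu.
have yzE := fsubsetP yz.
have near_u a' b' : a' \in y -> b' \in y -> closer u a' b' ->
    delaunay (u |` z)%fset a' u.
  move=> a'y b'y uab'.
  have [La Lb] := conj (zL _ (yzE _ a'y)) (zL _ (yzE _ b'y)).
  apply/delaunay_closer; rewrite ?in_fset1U ?eqxx ?(yzE _ a'y) ?orbT //.
    exact: network_fset1U.
  move=> x; rewrite in_fset1U => /predU1P[->|xz] xau.
    exact: not_closer_self (closerC xau).
  apply: (clique_closer zL yz clz a'y b'y xz).
  exact: closer_left La Lb Lu (zL _ xz) uab' xau.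
split; first by rewrite in_fset1U yzE ?orbT.
exists u; first by rewrite in_fset1.
have [->|->] := clique_general_position zL gp yz clz ay by_ cy (closer_neq uab).
  exact: near_u ay by_ uab.
exact: near_u by_ ay (closerC uab).
Qed.

(** Since [y] has only two points, [u] and [v] obstruct the same pair, and [closer_between]
    applies. *)
Lemma destroyed_twice (z y : {fset lpoint G}) u v :
  [set` z] `<=` L -> L u -> L v ->
  (y `<=` z)%fset -> general_position z -> clique y z ->
  ~ clique y (u |` z)%fset -> ~ clique y (v |` z)%fset ->
  delaunay (u |` (v |` z))%fset u v.
Proof.
move=> zL Lu Lv yz gp clz nclu nclv.
have [a [b [ay by_ uab]]] := clique_destroyed zL Lu yz clz nclu.
have [a' [b' [ay' by' vab']]] := clique_destroyed zL Lv yz clz nclv.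
have size2 := clique_general_position zL gp yz clz ay by_ _ (closer_neq uab).
have vab : closer v a b.
  have := vab'; have := closer_neq vab'.
  case: (size2 _ ay') (size2 _ by') => -> [] ->; rewrite ?eqxx //.
  by move=> _; apply: closerC.
have yzE := fsubsetP yz.
apply/delaunay_closer; rewrite ?in_fset1U ?eqxx ?orbT //.
  by apply: network_fset1U => //; apply: network_fset1U.
move=> x; rewrite !in_fset1U => /predU1P[->|/predU1P[->|xz]] xuv.
- exact: not_closer_self xuv.
- exact: not_closer_self (closerC xuv).
apply: (clique_closer zL yz clz ay by_ xz).
have La := zL _ (yzE _ ay); have Lb := zL _ (yzE _ by_).
exact: closer_between La Lb Lu Lv (zL _ xz) uab vab xuv.
Qed.

End TreeNetwork.

(** * The consistency conditions (C1) and (C2) *)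

Theorem theorem1 (R : realType) (G : euclidean_graph R) (tree_G : is_tree G)
    (z y : {fset lpoint G}) (u v : lpoint G)
    (z_L : [set` z] `<=` network G) (y_z : (y `<=` z)%fset)
    (u_L : network G u) (v_L : network G v)
    (u_z : u \notin z) (v_z : v \notin z) :
  (general_position (u |` z)%fset ->
   chi y z <> chi y (u |` z)%fset ->
   [set` y] `<=` neighbours [fset u]%fset (u |` z)%fset) /\
  (let x := (u |` (v |` z))%fset in
   general_position x ->
   ~ delaunay x u v ->
   (chi y (u |` z)%fset + chi y (v |` z)%fset = chi y z + chi y x)%N).
Proof.
have zu : (z `<=` u |` z)%fset by apply: fsubsetU1.
have zv : (z `<=` v |` z)%fset by apply: fsubsetU1.
split=> [gp chi_neq|x gp uNv].
  have gz := subset_general_position zu gp.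
  (* Adding points can only destroy cliques, so a change of [chi] means that [u] destroys the clique
     [y]. *)
  case: (pselect (clique y z)) => clz; last first.
    case: chi_neq; rewrite /chi !asboolF // => clu.
    exact: clz (subset_clique zu clu).
  case: (pselect (clique y (u |` z)%fset)) => clu.
    by case: chi_neq; rewrite /chi !asboolT.
  exact: destroyed_neighbours.
have ux : (u |` z `<=` x)%fset by apply: fsetUS.
have vx : (v |` z `<=` x)%fset by apply: fsubsetU1.
have gz := subset_general_position (fsubset_trans zu ux) gp.
have clxu := subset_clique (Z := y) ux; have clxv := subset_clique (Z := y) vx.
have cluz := subset_clique (Z := y) zu; have clvz := subset_clique (Z := y) zv.
have chiT X : clique y X -> chi y X = 1%N by move=> cl; rewrite /chi asboolT.
have chiF X : ~ clique y X -> chi y X = 0%N by move=> ncl; rewrite /chi asboolF.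
case: (pselect (clique y z)) => clz; last first.
  have nclu : ~ clique y (u |` z)%fset by move=> /cluz.
  have nclv : ~ clique y (v |` z)%fset by move=> /clvz.
  have nclx : ~ clique y x by exact: (fun cl => clz (cluz (clxu cl))).
  by rewrite (chiF _ clz) (chiF _ nclx) (chiF _ nclu) (chiF _ nclv).
case: (pselect (clique y x)) => clx.
  by rewrite (chiT _ clz) (chiT _ clx) (chiT _ (clxu clx)) (chiT _ (clxv clx)).
(* Here [y] is a clique in [z] but not in [x], so the right-hand side is 1 and exactly one of the
   two additions must preserve the clique. *)
have nuv : clique y (u |` z)%fset \/ clique y (v |` z)%fset.
  apply: contrapT => /not_orP[nclu nclv].
  exact/uNv/(destroyed_twice tree_G z_L u_L v_L y_z gz clz).
(* A point of [x] obstructing a pair of [y] is [u] or belongs to [z] with [v] added, so it already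
   obstructs in one of the two smaller configurations. *)
have nboth : ~ (clique y (u |` z)%fset /\ clique y (v |` z)%fset).
  move=> [clu clv].
  have uzL : [set` (u |` z)%fset] `<=` network G by apply: network_fset1U.
  have vzL : [set` (v |` z)%fset] `<=` network G by apply: network_fset1U.
  have [||a [b [w [ay by_ wx wab]]]] := not_clique tree_G _ _ clx.
  - exact: network_fset1U.
  - exact: fsubset_trans y_z (fsubset_trans zu ux).
  move: wx; rewrite in_fset1U => /predU1P[wu|wv].
    apply: (clique_closer tree_G uzL _ clu ay by_ _ wab).
      exact: fsubset_trans y_z zu.
    by rewrite wu in_fset1U eqxx.
  apply: (clique_closer tree_G vzL _ clv ay by_ wv wab).
  exact: fsubset_trans y_z zv.
rewrite (chiT _ clz) (chiF _ clx).
case: nuv => cl; rewrite (chiT _ cl).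
  by rewrite (chiF _ (fun cl' => nboth (conj cl cl'))).
by rewrite (chiF _ (fun cl' => nboth (conj cl' cl))).
Qed.
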